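(* Let $(E,C)$ be a separated graph and let $\gamma$ be a nonzero element of $\mathcal S(E,C)$. Then $$\gamma=(\gamma_1\gamma_1^{-1})\cdots(\gamma_n\gamma_n^{-1})\lambda,$$ where $\{\gamma_1,\dots,\gamma_n\}$ is an incomparable $C$-compatible family of $C$-separated paths, $\lambda\in\mathbb F_C$, the words $\gamma_j$ do not end in $E^{-1}$, $s(\gamma_j)=s(\gamma)=s(\lambda)$ for $j=1,\dots,n$, and $\gamma_i\gamma_i^{-1}=(\lambda\lambda^{-1})(\gamma_i\gamma_i^{-1})$ for some $i$. The latter condition is equivalent to the fact that $\lambda_0$ is a prefix of $\gamma_i$ for some $i$, where $\lambda=\lambda_0w$, $\lambda_0$ does not end in $E^{-1}$, and $w$ is a (possibly empty) product of elements of $E^{-1}$. Moreover this (Scheiblich) normal form is unique in the following sense: if $\gamma=(\gamma_1'(\gamma_1')^{-1})\cdots(\gamma_m'(\gamma_m')^{-1})\lambda'$ is another Scheiblich normal form for $\gamma$ (i.e. an expression satisfying the same conditions), then $\lambda=\lambda'$ and $\{\gamma_1,\dots,\gamma_n\}=\{\gamma_1',\dots,\gamma_m'\}$. In particular $n=m$. Conversely, elements $\gamma$ in Scheiblich normal form are nonzero in $\mathcal S(E,C)$.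
   Context: A directed graph $E=(E^0,E^1,s,r)$ consists of sets $E^0$ (vertices), $E^1$ (edges), of arbitrary cardinality, and maps $s,r\colon E^1\to E^0$. A separated graph $(E,C)$ is a directed graph with $C=\bigsqcup_{v\in E^0}C_v$, where $C_v$ is a partition of $s^{-1}(v)$ into pairwise disjoint nonempty subsets ($C_v=\emptyset$ if $s^{-1}(v)=\emptyset$). $E^{-1}=\{e^{-1}:e\in E^1\}$ is a set of formal inverses, $\hat E^1=E^1\sqcup E^{-1}$, $s(e^{-1})=r(e)$, $r(e^{-1})=s(e)$, $(e^{-1})^{-1}=e$. $\mathcal S(E,C)$ is the universal inverse semigroup with zero generated by $E^0\cup\hat E^1$ subject to: (1) $vw=\delta_{v,w}v$ for $v,w\in E^0$; (2) $s(x)x=x$ and (3) $xr(x)=x$ for $x\in\hat E^1$; (4) $e^{-1}f=\delta_{e,f}r(e)$ for $e,f\in X$, $X\in C$. For a nonzero $\gamma\in\mathcal S(E,C)$, $s(\gamma)$ is the unique vertex $v$ with $v\gamma=\gamma$. A path is a vertex or a word $y_1\cdots y_n$ with $y_i\in\hat E^1$, $r(y_i)=s(y_{i+1})$; its inverse is $y_n^{-1}\cdots y_1^{-1}$; paths are interpreted as elements of $\mathcal S(E,C)$ by multiplying their letters. A path is reduced if it contains no subword $xx^{-1}$, $x\in\hat E^1$; $\mathrm{red}(\gamma)$ denotes the reduction of $\gamma$ via $xx^{-1}\to s(x)$. A $C$-separated path is a reduced path (vertices included) with no subword $x^{-1}y$ with $x,y\in X$, $X\in C$; $\mathbb F_C$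 is the set of these and $\mathbb F_C(v)=\{w\in\mathbb F_C:s(w)=v\}$. The prefix order $\mu\le_p\nu$ means that $\mu$ is an initial segment of $\nu$; ''incomparable'' means pairwise incomparable for $\le_p$. A path ''ends in $E^{-1}$'' if it is not a vertex and its last letter is in $E^{-1}$. $\gamma,\nu\in\mathbb F_C(v)\setminus\{v\}$ are $C$-compatible if $\mathrm{red}(\nu^{-1}\gamma)\in\mathbb F_C$, and $v$ is $C$-compatible with all elements of $\mathbb F_C(v)$; a family in $\mathbb F_C(v)$ is $C$-compatible if its elements are pairwise $C$-compatible. Families have $n\ge1$ elements. *)

(* Defs.v *)
From HB Require Import structures.
From mathcomp Require Import all_boot generic_quotient.
From mathcomp Require Import boolp classical_sets.

Set Implicit Arguments.
Unset Strict Implicit.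
Unset Printing Implicit Defensive.

Local Open Scope group_scope.
Local Open Scope quotient_scope.

HB.mixin Record isInverseSemigroup0 S of Semigroup S := {
  zeroS : S;
  mul0S : forall x : S, zeroS * x = zeroS;
  mulS0 : forall x : S, x * zeroS = zeroS;
  invS : S -> S;
  mulSVS : forall x : S, x * invS x * x = x;
  mulVSV : forall x : S, invS x * x * invS x = invS x;
  invS_uniq : forall x y : S, x * y * x = x -> y * x * y = y -> y = invS x
}.

#[short(type="invSemigroup0Type")]
HB.structure Definition InverseSemigroup0 :=
  {S of isInverseSemigroup0 S & Semigroup S}.

(* [colour v] is the partition C_v.  It is empty when v emits no edge, since
   the blocks of a [partition] are nonempty. *)
Record separatedGraph := SeparatedGraph {
  vertex : Type;
  edge : Type;
  src : edge -> vertex;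
  rng : edge -> vertex;
  colour : vertex -> set (set edge);
  colour_partition :
    forall v, partition (colour v) id [set e | src e = v]%classic
}.

Definition colours (G : separatedGraph) : set (set (edge G)) :=
  [set X | exists v, colour v X]%classic.

Inductive letter (G : separatedGraph) := Pos of edge G | Inv of edge G.

HB.instance Definition _ (G : separatedGraph) := gen_eqMixin (vertex G).
HB.instance Definition _ (G : separatedGraph) := gen_eqMixin (letter G).

Section Paths.

Variable G : separatedGraph.

Definition lsrc (x : letter G) : vertex G :=
  match x with Pos e => src e | Inv e => rng e end.

Definition lrng (x : letter G) : vertex G :=
  match x with Pos e => rng e | Inv e => src e end.

Definition linv (x : letter G) : letter G :=
  match x with Pos e => Inv e | Inv e => Pos e end.

(* The vertex v is (v, [::]) and the word y1...yn is (s(y1), [:: y1; ...; yn]);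
   so [p.1] is the source of the path p. *)
Definition gpath : Type := vertex G * seq (letter G).

Definition is_path (p : gpath) : bool :=
  if p.2 is y :: w then
    (lsrc y == p.1) && path (fun x z => lrng x == lsrc z) y w
  else true.

Definition prng (p : gpath) : vertex G := last p.1 (map lrng p.2).

Definition pinv (p : gpath) : gpath := (prng p, rev (map linv p.2)).

Definition pcat (p q : gpath) : gpath := (p.1, p.2 ++ q.2).

Definition reduced (p : gpath) : Prop :=
  forall x, ~~ infix [:: x; linv x] p.2.

Definition red (p : gpath) : gpath :=
  (p.1, foldr (fun x w => if w is y :: w' then
                            if y == linv x then w' else x :: w
                          else [:: x]) [::] p.2).

Definition Cseparated (p : gpath) : Prop :=
  [/\ is_path p, reduced p &
      forall X e f, colours X -> X e -> X f -> ~~ infix [:: Inv e; Pos f] p.2].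

Definition prefix_le (p q : gpath) : bool := (p.1 == q.1) && prefix p.2 q.2.

Definition ends_in_inv (p : gpath) : Prop :=
  exists w e, p.2 = rcons w (Inv e).

(* Meant for C-separated p and q with the same source. *)
Definition Ccompatible (p q : gpath) : Prop :=
  [\/ p.2 = [::], q.2 = [::] | Cseparated (red (pcat (pinv q) p))].

Inductive term :=
  | Tzero
  | Tvertex of vertex G
  | Tletter of letter G
  | Tmul of term & term
  | Tinv of term.

(* The least congruence on terms whose quotient is an inverse semigroup with
   zero satisfying the defining relations of S(E,C). *)
Inductive cong : term -> term -> Prop :=
  | cong_refl a : cong a a
  | cong_sym a b : cong a b -> cong b a
  | cong_trans b a c : cong a b -> cong b c -> cong a c
  | cong_mul a a' b b' : cong a a' -> cong b b' -> cong (Tmul a b) (Tmul a' b')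
  | cong_inv a a' : cong a a' -> cong (Tinv a) (Tinv a')
  | cong_mulA a b c : cong (Tmul a (Tmul b c)) (Tmul (Tmul a b) c)
  | cong_mul0l a : cong (Tmul Tzero a) Tzero
  | cong_mul0r a : cong (Tmul a Tzero) Tzero
  | cong_mulaVa a : cong (Tmul (Tmul a (Tinv a)) a) a
  | cong_mulVaV a : cong (Tmul (Tmul (Tinv a) a) (Tinv a)) (Tinv a)
  | cong_inv_uniq a b : cong (Tmul (Tmul a b) a) a ->
      cong (Tmul (Tmul b a) b) b -> cong b (Tinv a)
  | cong_vertex v : cong (Tmul (Tvertex v) (Tvertex v)) (Tvertex v)
  | cong_vertex0 v w : v <> w -> cong (Tmul (Tvertex v) (Tvertex w)) Tzero
  | cong_src x : cong (Tmul (Tvertex (lsrc x)) (Tletter x)) (Tletter x)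
  | cong_rng x : cong (Tmul (Tletter x) (Tvertex (lrng x))) (Tletter x)
  | cong_colour X e : colours X -> X e ->
      cong (Tmul (Tletter (Inv e)) (Tletter (Pos e))) (Tvertex (rng e))
  | cong_colour0 X e f : colours X -> X e -> X f -> e <> f ->
      cong (Tmul (Tletter (Inv e)) (Tletter (Pos f))) Tzero.

HB.instance Definition _ := gen_eqMixin term.
HB.instance Definition _ := gen_choiceMixin term.

Definition congb (a b : term) : bool := `[< cong a b >].

Lemma congb_refl : reflexive congb.
Proof. by move=> a; apply/asboolP/cong_refl. Qed.

Lemma congb_sym : symmetric congb.
Proof. by move=> a b; apply/asboolP/asboolP; apply: cong_sym. Qed.

Lemma congb_trans : transitive congb.
Proof.
by move=> b a c /asboolP ab /asboolP bc; apply/asboolP/(cong_trans ab bc).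
Qed.

Canonical congb_equiv := EquivRel congb congb_refl congb_sym congb_trans.

Definition SEC : Type := {eq_quot congb_equiv}.

HB.instance Definition _ := Choice.copy SEC {eq_quot congb_equiv}.

Definition cls (a : term) : SEC := \pi_({eq_quot congb_equiv}) a.

Definition rep (x : SEC) : term := repr (x : {eq_quot congb_equiv}).

Lemma repK : cancel rep cls.
Proof. by move=> x; rewrite /cls /rep reprK. Qed.

Lemma clsP a b : cls a = cls b <-> cong a b.
Proof.
split=> [/eqP|ab]; first by rewrite /cls eqmodE => /asboolP.
by apply/eqP; rewrite /cls eqmodE; apply/asboolP.
Qed.

Lemma rep_cls a : cong (rep (cls a)) a.
Proof. by apply/clsP; rewrite repK. Qed.

Definition mulSEC (x y : SEC) : SEC := cls (Tmul (rep x) (rep y)).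
Definition invSEC (x : SEC) : SEC := cls (Tinv (rep x)).

Lemma mulSEC_cls a b : mulSEC (cls a) (cls b) = cls (Tmul a b).
Proof. by apply/clsP/cong_mul; apply: rep_cls. Qed.

Lemma invSEC_cls a : invSEC (cls a) = cls (Tinv a).
Proof. by apply/clsP/cong_inv; apply: rep_cls. Qed.

Lemma mulSECA : associative mulSEC.
Proof.
move=> x y z; rewrite -[x]repK -[y]repK -[z]repK !mulSEC_cls.
exact/clsP/cong_mulA.
Qed.

HB.instance Definition _ := isSemigroup.Build SEC mulSECA.

Lemma mulcls a b : cls a * cls b = cls (Tmul a b).
Proof. exact: mulSEC_cls. Qed.

Fact mul0SEC (x : SEC) : cls Tzero * x = cls Tzero.
Proof. by rewrite -[x]repK mulcls; apply/clsP/cong_mul0l. Qed.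

Fact mulSEC0 (x : SEC) : x * cls Tzero = cls Tzero.
Proof. by rewrite -[x]repK mulcls; apply/clsP/cong_mul0r. Qed.

Fact mulSECVS (x : SEC) : x * invSEC x * x = x.
Proof.
by rewrite -[x]repK invSEC_cls !mulcls; apply/clsP/cong_mulaVa.
Qed.

Fact mulVSECV (x : SEC) : invSEC x * x * invSEC x = invSEC x.
Proof.
by rewrite -[x]repK invSEC_cls !mulcls; apply/clsP/cong_mulVaV.
Qed.

Fact invSEC_uniq (x y : SEC) :
  x * y * x = x -> y * x * y = y -> y = invSEC x.
Proof.
rewrite -[x]repK -[y]repK invSEC_cls !mulcls => /clsP xyx /clsP yxy.
exact/clsP/cong_inv_uniq.
Qed.

HB.instance Definition _ := isInverseSemigroup0.Build SEC
  mul0SEC mulSEC0 mulSECVS mulVSECV invSEC_uniq.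

Definition vgen (v : vertex G) : SEC := cls (Tvertex v).
Definition lgen (x : letter G) : SEC := cls (Tletter x).

Definition satisfies_relations (T : invSemigroup0Type)
    (f : vertex G -> T) (g : letter G -> T) : Prop :=
  [/\ forall v w, f v * f w = if v == w then f v else zeroS,
      forall x, f (lsrc x) * g x = g x,
      forall x, g x * f (lrng x) = g x &
      forall X e f', colours X -> X e -> X f' ->
        g (Inv e) * g (Pos f') = if `[< e = f' >] then f (rng e) else zeroS].

Lemma SEC_relations : satisfies_relations vgen lgen.
Proof.
split=> [v w|x|x|X e e' CX Xe Xe']; rewrite /vgen /lgen ?mulcls.
- case: eqP => [<-|vw]; first exact/clsP/cong_vertex.
  exact/clsP/cong_vertex0.
- exact/clsP/cong_src.
- exact/clsP/cong_rng.
- case: asboolP => [<-|ee']; first exact/clsP/(cong_colour CX).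
  exact/clsP/(cong_colour0 CX).
Qed.

Definition is_extension (T : invSemigroup0Type)
    (f : vertex G -> T) (g : letter G -> T) (h : SEC -> T) : Prop :=
  [/\ forall x y, h (x * y) = h x * h y, h zeroS = zeroS,
      forall v, h (vgen v) = f v & forall x, h (lgen x) = g x].

Fixpoint evalT (T : invSemigroup0Type) (f : vertex G -> T) (g : letter G -> T)
    (a : term) : T :=
  match a with
  | Tzero => zeroS
  | Tvertex v => f v
  | Tletter x => g x
  | Tmul a b => evalT f g a * evalT f g b
  | Tinv a => invS (evalT f g a)
  end.

Lemma evalT_cong (T : invSemigroup0Type)
    (f : vertex G -> T) (g : letter G -> T) a b :
  satisfies_relations f g -> cong a b -> evalT f g a = evalT f g b.
Proof.
case=> [fv fs fr fc]; elim=> //=.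
- by move=> ? ? ? _ -> _ ->.
- by move=> ? ? ? ? _ -> _ ->.
- by move=> ? ? _ ->.
- by move=> *; rewrite mulgA.
- by move=> *; rewrite mul0S.
- by move=> *; rewrite mulS0.
- by move=> *; rewrite mulSVS.
- by move=> *; rewrite mulVSV.
- by move=> *; apply: invS_uniq.
- by move=> *; rewrite fv eqxx.
- by move=> v w /eqP/negbTE vw; rewrite fv vw.
- by move=> X e CX Xe; rewrite (fc X e e) // asboolT.
- by move=> X e e' CX Xe Xe' ee'; rewrite (fc X e e') // asboolF.
Qed.

Lemma SEC_universal (T : invSemigroup0Type)
    (f : vertex G -> T) (g : letter G -> T) :
  satisfies_relations f g -> exists! h, is_extension f g h.
Proof.
move=> fg; have hE a : evalT f g (rep (cls a)) = evalT f g a.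
  exact/(evalT_cong fg)/rep_cls.
exists (fun x => evalT f g (rep x)); split; first split.
- by move=> x y; rewrite -[x]repK -[y]repK mulcls !hE.
- exact: hE.
- by move=> v; apply: hE.
- by move=> x; apply: hE.
move=> h [hM h0 hv hl]; apply/funext => x; rewrite -[x in RHS]repK.
elim: (rep x) => [|v|y|a IHa b IHb|a IHa] /=.
- by rewrite -/zeroS h0.
- by rewrite hv.
- by rewrite hl.
- by rewrite -mulcls hM IHa IHb.
- rewrite IHa -invSEC_cls; apply/esym/invS_uniq; rewrite -!hM.
  + by rewrite mulSECVS.
  + by rewrite mulVSECV.
Qed.

Definition elt (p : gpath) : SEC :=
  if p.2 is y :: w then foldl (fun x z => x * lgen z) (lgen y) w else vgen p.1.

Definition idem (p : gpath) : SEC := elt p * elt (pinv p).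

Definition nf_value (gs : seq gpath) (lam : gpath) : SEC :=
  foldr (fun p x => idem p * x) (elt lam) gs.

(* s(x) = v; only used for nonzero x. *)
Definition is_source (x : SEC) (v : vertex G) : Prop :=
  unique (fun u => vgen u * x = x) v.

(* The family gamma_1, ..., gamma_n is listed, without repetition because of
   pairwise incomparability, by the sequence [gs]. *)
Record scheiblich_family (gs : seq gpath) (lam : gpath) : Prop := {
  family_nonempty : (0 < size gs)%N;
  family_Cseparated : {in gs, forall p, Cseparated p};
  family_incomparable :
    pairwise (fun p q => ~~ prefix_le p q && ~~ prefix_le q p) gs;
  family_Ccompatible : {in gs &, forall p q, Ccompatible p q};
  family_ends : {in gs, forall p, ~ ends_in_inv p};
  family_lam : Cseparated lam;
  family_source : {in gs, forall p, p.1 = lam.1}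
}.

Definition dominated (gs : seq gpath) (lam : gpath) : Prop :=
  exists2 p, p \in gs & idem p = idem lam * idem p.

Definition scheiblich_normal (gs : seq gpath) (lam : gpath) : Prop :=
  scheiblich_family gs lam /\ dominated gs lam.

Definition scheiblich_form (x : SEC) (gs : seq gpath) (lam : gpath) : Prop :=
  [/\ x = nf_value gs lam, scheiblich_normal gs lam & is_source x lam.1].

(* lam = lam0 w, where w is a product of elements of E^{-1}. *)
Definition stem_decomposition (lam lam0 : gpath) (w : seq (edge G)) : Prop :=
  lam = (lam0.1, lam0.2 ++ map (@Inv G) w) /\ ~ ends_in_inv lam0.

End Paths.

(* Main.v *)
Require Import Defs.
From HB Require Import structures.
From mathcomp Require Import all_boot.
From mathcomp Require Import boolp.

(** The theorem is a version of Munn's description of free inverse semigroups: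
    an element of S(E,C) amounts to a finite tree of paths together with an end
    point [lam].  The tree is the set of prefixes of the [gamma_i], enlarged by
    trailing letters of E^-1, which cost nothing because [Inv e * Pos e] is
    already a vertex.

    Existence.  The product of an element in the shape (idempotents of paths)
    times [lam] with a letter is again of this shape or zero
    ([preform_mul_lgen]): the letter extends [lam], or meets a letter of the
    same colour and gives zero, or cancels the last letter of [lam], whose
    idempotent is then recorded.  As the generators are closed under inversion,
    every nonzero element has this shape ([zero_or_preform_all]).  Idempotents
    commute, so the idempotent of a prefix of a listed path is absorbed
    ([idem_prefix]) and only maximal paths need be kept; trailing inverse
    letters do not change an idempotent ([idem_invs]); and the idempotents of
    two incompatible paths multiply to zero, because such paths branch by two
    edges of one colour ([Cincompatible_fork], [incompatible0]).  The idempotent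
    of [lam] can always be added to the list, which gives domination.

    Uniqueness and nonvanishing.  Any set [W] of reduced paths that is closed
    under prefixes and under inverse letters, and has at most one edge of each
    colour leaving each of its points, carries a representation of S(E,C) by
    partial bijections in which a letter sends a path to its reduced product
    with that letter ([tree_relations]).  Run from the root, a normal form is
    defined exactly when [W] contains all [gamma_i] and [lam], and it then ends
    at [lam] ([family_reading]).  The tree spanned by a compatible family is
    such a set [W] ([hull_tree]).  Acting on its own tree a normal form is defined,
    hence nonzero; an equal normal form is defined there too, ends at the same
    point, and has its paths in that tree.  By symmetry each of the two
    antichains lies below the other, so they coincide ([normal_subset]).  The
    same action turns domination into membership of [lam] in the tree, which is
    the prefix condition ([dominated_stem]). *)

Set Implicit Arguments.
Unset Strict Implicit.
Unset Printing Implicit Defensive.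

Local Open Scope group_scope.

(** * Inverse semigroups *)

Section InverseSemigroups.

Variable T : invSemigroup0Type.
Implicit Types x y e f : T.

Lemma invS_idempotent e : e * e = e -> invS e = e.
Proof. by move=> ee; apply/esym/invS_uniq; rewrite !ee. Qed.

Lemma invSK : involutive (@invS T).
Proof. by move=> x; apply/esym/invS_uniq; rewrite ?mulSVS ?mulVSV. Qed.

Lemma mulSV_idempotent x : x * invS x * (x * invS x) = x * invS x.
Proof. by rewrite mulgA mulSVS. Qed.

Lemma mulVS_idempotent x : invS x * x * (invS x * x) = invS x * x.
Proof. by rewrite mulgA mulVSV. Qed.

(** The inverse [y] of [e * f] equals [f * y * e], which is an idempotent; so
    [e * f], being the inverse of [y], is an idempotent too. *)
Lemma idempotent_mul e f : e * e = e -> f * f = f -> e * f * (e * f) = e * f.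
Proof.
move=> ee ff; have VV := mulVSV (e * f); have VS := mulSVS (e * f).
have yE : f * invS (e * f) * e = invS (e * f).
  move: VV VS; set y := invS _ => VV VS; apply: invS_uniq.
    by rewrite -[in RHS]VS !mulgA -(mulgA e f f) ff -(mulgA _ e e) ee.
  rewrite -[in RHS]VV !mulgA.
  by rewrite -(mulgA _ e e) ee -(mulgA _ f f) ff.
have yy : f * invS (e * f) * e * (f * invS (e * f) * e) = f * invS (e * f) * e.
  by rewrite -[in RHS]VV !mulgA.
by rewrite yE in yy; have := invS_idempotent yy; rewrite invSK => ->.
Qed.

(** Both [e * f] and [f * e] are idempotents by the previous lemma, and each is
    an inverse of [e * f]. *)
Lemma idempotents_commute e f : e * e = e -> f * f = f -> e * f = f * e.
Proof.
move=> ee ff; have ef := idempotent_mul ee ff; have fe := idempotent_mul ff ee.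
rewrite -{1}(invS_idempotent ef); apply/esym/invS_uniq.
  by rewrite -{3}ef !mulgA -(mulgA _ f f) ff -(mulgA _ e e) ee.
by rewrite -{3}fe !mulgA -(mulgA _ e e) ee -(mulgA _ f f) ff.
Qed.

Lemma invSM x y : invS (x * y) = invS y * invS x.
Proof.
have C := idempotents_commute (mulVS_idempotent x) (mulSV_idempotent y).
apply/esym/invS_uniq.
  have -> : x * y * (invS y * invS x) * (x * y)
          = x * (y * invS y * (invS x * x)) * y by rewrite !mulgA.
  by rewrite -C !mulgA mulSVS -!mulgA (mulgA y) mulSVS.
have -> : invS y * invS x * (x * y) * (invS y * invS x)
        = invS y * (invS x * x * (y * invS y)) * invS x by rewrite !mulgA.
by rewrite C !mulgA mulVSV -!mulgA (mulgA (invS x)) mulVSV.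
Qed.

Lemma invS0 : invS (zeroS : T) = zeroS.
Proof. by apply: invS_idempotent; rewrite mul0S. Qed.

End InverseSemigroups.

(** * Partial bijections *)

Section PartialBijections.

Variable A : Type.

(** Relations are used instead of partial functions, so that the inverse is
    the converse relation and composition needs no case analysis. *)
Record pbij := PBij {
  prel :> A -> A -> Prop;
  pbij_fun : forall a b c, prel a b -> prel a c -> b = c;
  pbij_inj : forall a b c, prel a c -> prel b c -> a = b
}.

Lemma pbij_ext (f g : pbij) : (forall a b, f a b <-> g a b) -> f = g.
Proof.
case: f g => [f f1 f2] [g g1 g2] /= fg.
have E : f = g by apply/funext => a; apply/funext => b; apply/propext.
by subst g; congr PBij; apply: Prop_irrelevance.
Qed.

Definition pbij0 : pbij :=
  @PBij (fun _ _ => False)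
    (fun _ _ _ => @False_ind _) (fun _ _ _ => @False_ind _).

Definition pbij_inv (f : pbij) : pbij :=
  @PBij (fun a b => f b a) (fun a b c => @pbij_inj f b c a)
    (fun a b c => @pbij_fun f c a b).

Fact comp_fun (f g : pbij) a b c :
  (exists2 d, f a d & g d b) -> (exists2 d, f a d & g d c) -> b = c.
Proof.
move=> [d ad db] [d' ad' dc].
by rewrite -(pbij_fun ad ad') in dc; apply: pbij_fun db dc.
Qed.

Fact comp_inj (f g : pbij) a b c :
  (exists2 d, f a d & g d c) -> (exists2 d, f b d & g d c) -> a = b.
Proof.
move=> [d ad dc] [d' bd' dc'].
by rewrite -(pbij_inj dc dc') in bd'; apply: pbij_inj ad bd'.
Qed.

Definition pbij_mul (f g : pbij) : pbij :=
  @PBij (fun a c => exists2 b, f a b & g b c) (@comp_fun f g) (@comp_inj f g).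

HB.instance Definition _ := gen_eqMixin pbij.
HB.instance Definition _ := gen_choiceMixin pbij.

Fact pbij_mulA : associative pbij_mul.
Proof.
move=> f g h; apply: pbij_ext => a b; split=> /=.
  by move=> [c ac [d cd db]]; exists d => //; exists c.
by move=> [d [c ac cd] db]; exists c => //; exists d.
Qed.

HB.instance Definition _ := isSemigroup.Build pbij pbij_mulA.

Fact pbij_mul0 (f : pbij) : pbij0 * f = pbij0.
Proof. by apply: pbij_ext => a b; split=> // -[]. Qed.

Fact pbij_mul0r (f : pbij) : f * pbij0 = pbij0.
Proof. by apply: pbij_ext => a b; split=> // -[]. Qed.

Fact pbij_mulVK (f : pbij) : f * pbij_inv f * f = f.
Proof.
apply: pbij_ext => a b; split=> /= [[c [d ad cd] cb]|ab].
  by rewrite (pbij_inj ad cd).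
by exists a => //; exists b.
Qed.

Fact pbij_mulKV (f : pbij) : pbij_inv f * f * pbij_inv f = pbij_inv f.
Proof.
apply: pbij_ext => a b; split=> /= [[c [d da dc] bc]|ba].
  by rewrite (pbij_fun da dc).
by exists a => //; exists b.
Qed.

Fact pbij_inv_uniq (f g : pbij) :
  f * g * f = f -> g * f * g = g -> g = pbij_inv f.
Proof.
move=> fgf gfg; apply: pbij_ext => a b; split=> /= h.
  have : prel (g * f * g)%g a b by rewrite gfg.
  case=> d [c ac cd] db; rewrite (pbij_fun h ac).
  by rewrite (pbij_inj h db).
have : prel (f * g * f)%g b a by rewrite fgf.
case=> d [c bc cd] da; rewrite (pbij_fun h bc).
by rewrite (pbij_inj h da).
Qed.

HB.instance Definition _ := isInverseSemigroup0.Build pbij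
  pbij_mul0 pbij_mul0r pbij_mulVK pbij_mulKV pbij_inv_uniq.

End PartialBijections.

(** * Paths as chains of letters *)

Section Walks.

Variable G : separatedGraph.
Implicit Types (v : vertex G) (x y : letter G) (a b q w : seq (letter G)).
Implicit Types (R : rel (letter G)).

Lemma linvK : involutive (@linv G). Proof. by case. Qed.

Lemma lsrc_linv x : lsrc (linv x) = lrng x. Proof. by case: x. Qed.

Lemma lrng_linv x : lrng (linv x) = lsrc x. Proof. by case: x. Qed.

(** The colour condition on letters: [linv x] followed by [y] violates it exactly
    when [conflict x y].  Stated for [x] and [y], it is symmetric. *)
Definition conflict x y : bool :=
  `[< exists X e f, [/\ colours X, X e, X f, x = Pos e & y = Pos f] >].

Definition plink x y := lrng x == lsrc y.
Definition rlink x y := plink x y && (y != linv x).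
Definition clink x y := rlink x y && ~~ conflict (linv x) y.

Lemma conflict_sym x y : conflict x y -> conflict y x.
Proof.
by move=> /asboolP[X [e [f [CX Xe Xf xe yf]]]]; apply/asboolP; exists X, f, e.
Qed.

Lemma rlinkW : subrel clink rlink. Proof. by move=> x y /andP[]. Qed.

Lemma plinkW : subrel rlink plink. Proof. by move=> x y /andP[]. Qed.

Lemma clink_linv x y : clink x y -> clink (linv y) (linv x).
Proof.
rewrite /clink /rlink /plink lrng_linv lsrc_linv linvK.
case/andP=> /andP[/eqP-> yx] /negP xy; rewrite eqxx /=; apply/andP; split.
  by rewrite eq_sym.
by apply/negP => /conflict_sym.
Qed.

(** C-separation and reducedness are conditions on consecutive letters; stated
    with [sorted] they pass to subwords and glue along concatenations. *)
Definition walk R v w : bool :=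
  (if w is y :: _ then lsrc y == v else true) && sorted R w.

Lemma is_pathE v w : is_path (v, w) = walk plink v w.
Proof. by rewrite /is_path /walk; case: w. Qed.

Lemma sub_walk R R' v w : subrel R R' -> walk R v w -> walk R' v w.
Proof. by move=> RR' /andP[vw Rw]; rewrite /walk vw (sub_sorted RR'). Qed.

Lemma infix2_sorted R w :
  sorted R w <-> (forall x y, infix [:: x; y] w -> R x y).
Proof.
split=> [Rw x y xyw|].
  by have := infix_sorted xyw Rw; rewrite /= andbT.
elim: w => [|z [|t w] IHw] // h; rewrite [sorted _ _]/=; apply/andP; split.
  by apply: h; apply/infixP; exists [::], w.
by apply: IHw => x y xy; apply: h; apply: infix_trans xy (infix_cons _ _).
Qed.

Lemma CseparatedE v w : Cseparated (v, w) <-> walk clink v w.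
Proof.
split.
  rewrite /Cseparated /reduced is_pathE /= => -[/andP[vw pw] red_w sep_w].
  rewrite /walk vw; apply/infix2_sorted => x y xyw; rewrite /clink /rlink.
  rewrite (infix2_sorted plink w).1 //=; apply/andP; split.
    by apply/negP => /eqP yx; have := red_w x; rewrite -yx xyw.
  apply/negP => /asboolP[X [e [f [CX Xe Xf xe yf]]]].
  have := sep_w X e f CX Xe Xf.
  by rewrite -yf -[Inv e]/(linv (Pos e)) -xe linvK xyw.
move=> cw; have /andP[_ /infix2_sorted h] := cw; split.
- by rewrite is_pathE; apply: sub_walk cw => x y /rlinkW/plinkW.
- by move=> x; apply/negP => /h; rewrite /clink /rlink eqxx andbF.
- move=> X e f CX Xe Xf; apply/negP => /h /andP[_] /negP; apply; apply/asboolP.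
  by exists X, e, f.
Qed.

Lemma walk_cat R v a b : subrel R plink -> walk R v (a ++ b) ->
  walk R v a /\ walk R (prng (v, a)) b.
Proof.
move=> Rp; rewrite /walk /prng; case: a => [|x a] //= /andP[-> xab].
move: xab; rewrite cat_path => /andP[-> ]; split=> //.
rewrite last_map; case: b b0 => [|y b] //= /andP[/Rp/eqP<-] ->.
by rewrite eqxx.
Qed.

Lemma walk_rcons R v w x : walk R v w -> prng (v, w) = lsrc x ->
  (forall a y, w = rcons a y -> R y x) -> walk R v (rcons w x).
Proof.
rewrite /walk /prng; case: (lastP w) => [|a y] /=.
  by move=> _ -> _; rewrite eqxx.
move=> /andP[va Ra] _ /(_ a y erefl) yx.
case: a va Ra => [|z a] /= -> //=; first by rewrite yx.
by rewrite !rcons_path last_rcons yx => ->.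
Qed.

Lemma prng_rcons v w x : prng (v, rcons w x) = lrng x.
Proof. by rewrite /prng map_rcons last_rcons. Qed.

Lemma prng_cat v a b : prng (v, a ++ b) = prng (prng (v, a), b).
Proof. by rewrite /prng map_cat last_cat. Qed.

Lemma prng_walk_rcons R v w x : subrel R plink ->
  walk R v (rcons w x) -> prng (v, w) = lsrc x.
Proof.
by move=> Rp; rewrite -cats1 => /(walk_cat Rp)[_ /andP[/eqP]].
Qed.

Definition winv w := rev (map (@linv G) w).

Lemma pinvE v w : pinv (v, w) = (prng (v, w), winv w). Proof. by []. Qed.

Lemma winv_cat a b : winv (a ++ b) = winv b ++ winv a.
Proof. by rewrite /winv map_cat rev_cat. Qed.

Lemma winv_rcons a x : winv (rcons a x) = linv x :: winv a.
Proof. by rewrite /winv map_rcons rev_rcons. Qed.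

Lemma winv_cons a x : winv (x :: a) = rcons (winv a) (linv x).
Proof. by rewrite /winv /= rev_cons. Qed.

Lemma sorted_winv R w : (forall x y, R x y -> R (linv y) (linv x)) ->
  sorted R w -> sorted R (winv w).
Proof.
by move=> Rl; rewrite /winv rev_sorted; apply: homo_sorted => x y /Rl.
Qed.

Lemma walk_winv v w : walk clink v w -> walk clink (prng (v, w)) (winv w).
Proof.
move=> /andP[_ cw]; rewrite /walk (sorted_winv clink_linv) // andbT.
by case/lastP: w {cw} => // w x; rewrite prng_rcons winv_rcons lsrc_linv.
Qed.

(** * Reduction of the product of a path with the inverse of another *)

Definition red_step x w :=
  if w is y :: w' then if y == linv x then w' else x :: w else [:: x].

Lemma redE v w : red (v, w) = (v, foldr red_step [::] w). Proof. by []. Qed.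

Lemma red_step_cat a b : sorted rlink (a ++ b) -> foldr red_step b a = a ++ b.
Proof.
elim: a => //= x a IHa xab; rewrite IHa; last exact: path_sorted xab.
by case: (a ++ b) xab => //= y c /andP[/andP[_ /negbTE->]].
Qed.

Lemma red_step_winv q b : foldr red_step (q ++ b) (winv q) = b.
Proof.
elim: q => //= x q IHq; rewrite winv_cons -cats1 foldr_cat /= linvK eqxx.
exact: IHq.
Qed.

(** Paths out of a common vertex branch after their longest common prefix [q];
    this is all that is left of [q] in the reduction of the quotient. *)
Lemma red_quotient v q a b :
  sorted rlink (q ++ b) -> sorted rlink (winv a ++ b) ->
  red (pcat (pinv (v, q ++ a)) (v, q ++ b)) = (prng (v, q ++ a), winv a ++ b).
Proof.
move=> qb ab; rewrite /pcat pinvE redE winv_cat /= !foldr_cat; congr pair.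
have -> : foldr red_step (foldr red_step [::] b) q = q ++ b.
  by rewrite -foldr_cat red_step_cat ?cats0.
by rewrite red_step_winv red_step_cat.
Qed.

Definition diverge a b :=
  if a is x :: _ then if b is y :: _ then x != y else true else true.

Lemma common_prefix a b :
  exists q a' b', [/\ a = q ++ a', b = q ++ b' & diverge a' b'].
Proof.
elim: a b => [|x a IHa] [|y b]; first by exists [::], [::], [::].
- by exists [::], [::], (y :: b).
- by exists [::], (x :: a), [::].
have [<-|xy] := eqVneq x y; last by exists [::], (x :: a), (y :: b).
have [q [a' [b' [-> -> d]]]] := IHa b.
by exists (x :: q), a', b'.
Qed.

Lemma sorted_winv_cat R x y a b : (forall x y, R x y -> R (linv y) (linv x)) ->
  sorted R (x :: a) -> sorted R (y :: b) -> R (linv x) y ->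
  sorted R (winv (x :: a) ++ y :: b).
Proof.
move=> Rl /(sorted_winv Rl); rewrite winv_cons sorted_cat_cons => xa yb xy.
rewrite -[path R y b]/(sorted R (y :: b)) yb andbT.
case: (winv a) xa => [|z c] /=; first by rewrite xy.
by rewrite !rcons_path last_rcons => ->; rewrite xy.
Qed.

Lemma rlink_linv x y : rlink x y -> rlink (linv y) (linv x).
Proof.
rewrite /rlink /plink lrng_linv lsrc_linv linvK => /andP[/eqP-> yx].
by rewrite eqxx eq_sym.
Qed.

Lemma walk_csep_prefix v a b : walk clink v (a ++ b) -> walk clink v a.
Proof. by case/walk_cat=> // x y /rlinkW/plinkW. Qed.

Lemma rlink_fork v q x y a b : walk clink v (q ++ x :: a) ->
  walk clink v (q ++ y :: b) -> x != y -> rlink (linv x) y.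
Proof.
have cp : subrel clink plink by move=> ? ? /rlinkW/plinkW.
case/(walk_cat cp)=> _ /andP[/eqP sx _].
case/(walk_cat cp)=> _ /andP[/eqP sy _].
by rewrite /rlink /plink lrng_linv sx sy linvK eqxx eq_sym.
Qed.

(** C-compatible paths never leave a common prefix by two distinct edges of
    the same colour. *)
Lemma Ccompatible_no_fork v q x y a b :
  walk clink v (q ++ x :: a) -> walk clink v (q ++ y :: b) ->
  Ccompatible (v, q ++ y :: b) (v, q ++ x :: a) -> conflict x y -> x = y.
Proof.
move=> wa wb cpt xy; apply/eqP/negP => /negP nxy.
have r := rlink_fork wa wb nxy.
have rsub w : sorted clink w -> sorted rlink w by apply/sub_sorted/rlinkW.
have [_ sa] := andP wa; have [_ sb] := andP wb.
case: cpt => /=; [by case: q {wa wb sa sb} | by case: q {wa wb sa sb} |].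
have sab : sorted rlink (winv (x :: a) ++ y :: b).
  apply: sorted_winv_cat rlink_linv _ _ r.
    by case/cat_sorted2: (rsub _ sa).
  by case/cat_sorted2: (rsub _ sb).
rewrite red_quotient //; last exact: rsub.
case/CseparatedE/andP=> _; rewrite winv_cons cat_rcons.
by case/cat_sorted2=> _ /= /andP[/andP[_]]; rewrite linvK xy.
Qed.

(** Conversely such a fork is the only way for two C-separated paths to be
    C-incompatible. *)
Lemma Cincompatible_fork v a b : walk clink v a -> walk clink v b ->
  ~ Ccompatible (v, b) (v, a) ->
  exists q x y a' b',
    [/\ a = q ++ x :: a', b = q ++ y :: b', x != y & conflict x y].
Proof.
move=> wa wb ncpt; have [q [a' [b' [aE bE]]]] := common_prefix a b.
have cp : subrel clink plink by move=> ? ? /rlinkW/plinkW.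
have rsub w : sorted clink w -> sorted rlink w by apply/sub_sorted/rlinkW.
have redC : sorted rlink (winv a' ++ b') ->
    ~ walk clink (prng (v, a)) (winv a' ++ b').
  move=> sab wab; apply: ncpt; apply: Or33; rewrite aE bE red_quotient //.
    by apply/CseparatedE; rewrite -aE.
  by apply: rsub; rewrite -bE; case/andP: wb.
have {}redC : ~ walk clink (prng (v, a)) (winv a' ++ b').
  by move=> wab; apply: redC (wab) => //; apply: rsub; case/andP: wab.
subst a b; case/(walk_cat cp): (wa) => _ wa'; case/(walk_cat cp): (wb) => _ wb'.
case: a' b' wa wb redC wa' wb' {ncpt} => [|x a'] [|y b'] wa wb redC wa' wb' xy.
- by case: redC.
- by case: redC; rewrite cats0.
- by case: redC; rewrite cats0 prng_cat; apply: walk_winv.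
exists q, x, y, a', b'; split=> //; apply/negP => /negP nc; apply: redC.
have := walk_winv wa'; rewrite -prng_cat /walk => /andP[hd _].
apply/andP; split; last first.
  apply: (sorted_winv_cat clink_linv); [by case/andP: wa'|by case/andP: wb'|].
  by rewrite /clink (rlink_fork wa wb) // linvK.
by move: hd; rewrite winv_cons; case: (winv a').
Qed.

End Walks.

(** * Calculus of paths in S(E,C) *)

Section Words.

Variable G : separatedGraph.
Implicit Types (v u : vertex G) (x y : letter G) (a b w : seq (letter G)).
Implicit Types (p q : gpath G) (gs : seq (gpath G)) (s t z : SEC G).

(** Associativity on the carrier itself, so that rewriting with it leaves the
    multiplication in a single syntactic form. *)
Lemma mulsA s t z : s * (t * z) = s * t * z.
Proof. exact: mulgA. Qed.

Lemma vgen_idempotent v : vgen v * vgen v = vgen v.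
Proof. by have [-> _ _ _] := SEC_relations G; rewrite eqxx. Qed.

Lemma vgen_orthogonal v u : v != u -> vgen v * vgen u = zeroS.
Proof. by have [-> _ _ _ /negbTE->] := SEC_relations G. Qed.

Lemma vgen_lgen x : vgen (lsrc x) * lgen x = lgen x.
Proof. by have [_ -> _ _] := SEC_relations G. Qed.

Lemma lgen_vgen x : lgen x * vgen (lrng x) = lgen x.
Proof. by have [_ _ -> _] := SEC_relations G. Qed.

Lemma lgen_conflict x y : conflict x y ->
  lgen (linv x) * lgen y = if x == y then vgen (lrng x) else zeroS.
Proof.
have [_ _ _ h] := SEC_relations G.
move=> /asboolP[X [e [f [CX Xe Xf -> ->]]]] /=; rewrite (h X) //.
case: asboolP => [->|ef]; first by rewrite eqxx.
by case: eqP => // -[].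
Qed.

(** Every edge has a colour, because the blocks of a partition cover. *)
Lemma conflict_Pos (e : edge G) : conflict (Pos e) (Pos e).
Proof.
have [cov _ _] := colour_partition (src e).
have : classical_sets.bigcup (colour (src e)) id e.
  by rewrite -[classical_sets.bigcup _ _]/(classical_sets.cover _ _) cov.
case=> X CX Xe; apply/asboolP; exists X, e, e; split=> //.
by exists (src e).
Qed.

Lemma invS_lgen x : invS (lgen x) = lgen (linv x).
Proof.
have EV (e : edge G) : lgen (Inv e) * lgen (Pos e) = vgen (rng e).
  by rewrite -[Inv e]/(linv (Pos e)) (lgen_conflict (conflict_Pos e)) eqxx.
have h (e : edge G) : lgen (Inv e) = invS (lgen (Pos e)).
  apply: invS_uniq; last by rewrite EV -[rng e]/(lsrc (Inv e)) vgen_lgen.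
  by rewrite -mulsA EV -[rng e]/(lrng (Pos e)) lgen_vgen.
by case: x => e /=; rewrite ?h ?invSK.
Qed.

(** Starting the product at the vertex [v] makes it multiplicative for
    concatenation without a case for the empty word; it agrees with [elt] on
    paths. *)
Definition word v w : SEC G := foldl (fun s x => s * lgen x) (vgen v) w.

Lemma foldl_mul s t w :
  foldl (fun s x => s * lgen x) (s * t) w
  = s * foldl (fun s x => s * lgen x) t w.
Proof. by elim: w t => //= x w IHw t; rewrite -mulsA IHw. Qed.

Lemma word_rcons v w x : word v (rcons w x) = word v w * lgen x.
Proof. by rewrite /word foldl_rcons. Qed.

Lemma word_vgen v w : word v w * vgen (prng (v, w)) = word v w.
Proof.
case/lastP: w => [|w x]; first exact: vgen_idempotent.
by rewrite word_rcons prng_rcons -mulsA lgen_vgen.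
Qed.

Lemma vgen_word v w : vgen v * word v w = word v w.
Proof. by rewrite /word -foldl_mul vgen_idempotent. Qed.

Lemma word_cat v a b : word v (a ++ b) = word v a * word (prng (v, a)) b.
Proof. by rewrite -[in RHS]foldl_mul word_vgen /word foldl_cat. Qed.

Lemma word_cons x w : word (lsrc x) (x :: w) = lgen x * word (lrng x) w.
Proof. by rewrite -cat1s word_cat /word /= vgen_lgen. Qed.

Lemma eltE p : is_path p -> elt p = word p.1 p.2.
Proof.
case: p => v [|y w] //= /andP[/eqP/= <- _].
by rewrite /elt /word /= vgen_lgen.
Qed.

Lemma invS_word v w : is_path (v, w) ->
  invS (word v w) = word (prng (v, w)) (winv w).
Proof.
rewrite is_pathE; elim/last_ind: w => [|w x IHw] wx.
  exact/invS_idempotent/vgen_idempotent.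
have pp : subrel (@plink G) (@plink G) by [].
have pw : walk (@plink G) v w by move: wx; rewrite -cats1 => /walk_cat[].
rewrite word_rcons invSM invS_lgen IHw //.
rewrite prng_rcons winv_rcons -cat1s word_cat.
rewrite (prng_walk_rcons pp wx) -[prng (_, [:: _])]/(lrng (linv x)) lrng_linv.
by rewrite /word /= -lsrc_linv vgen_lgen.
Qed.

Lemma is_path_pinv p : is_path p -> is_path (pinv p).
Proof.
case: p => v w; rewrite is_pathE pinvE is_pathE => /andP[_ ww].
rewrite /walk sorted_winv ?andbT //.
  by case/lastP: w {ww} => // w x; rewrite prng_rcons winv_rcons lsrc_linv.
by move=> x y; rewrite /plink lrng_linv lsrc_linv eq_sym.
Qed.

Lemma elt_pinv p : is_path p -> elt (pinv p) = invS (elt p).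
Proof.
move=> pp; rewrite (eltE pp) (eltE (is_path_pinv pp)).
by case: p pp => v w pp; rewrite invS_word.
Qed.

Lemma idemE p : is_path p -> idem p = elt p * invS (elt p).
Proof. by move=> pp; rewrite /idem elt_pinv. Qed.

Lemma idem_idempotent p : is_path p -> idem p * idem p = idem p.
Proof. by move=> pp; rewrite idemE // mulSV_idempotent. Qed.

Lemma idem_commute p q :
  is_path p -> is_path q -> idem p * idem q = idem q * idem p.
Proof. by move=> pp qp; apply: idempotents_commute; apply: idem_idempotent. Qed.

Lemma is_path_cat v a b : is_path (v, a ++ b) -> is_path (v, a).
Proof. by rewrite !is_pathE => /walk_cat[]. Qed.

Lemma elt_cat v a b : is_path (v, a ++ b) ->
  elt (v, a ++ b) = elt (v, a) * word (prng (v, a)) b.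
Proof. by move=> ab; rewrite !eltE ?(is_path_cat ab) // word_cat. Qed.

(** In the natural order longer paths have smaller idempotents. *)
Lemma idem_prefix p q : is_path q -> prefix_le p q -> idem p * idem q = idem q.
Proof.
case: p q => v a [u c] ab /andP[/= /eqP vu /prefixP[b cE]]; subst u c.
rewrite !idemE ?(is_path_cat ab) // elt_cat //.
by rewrite -!mulsA (mulsA (elt _)) (mulsA _ (elt _)) mulSVS.
Qed.

Lemma vgen_elt p : is_path p -> vgen p.1 * elt p = elt p.
Proof. by move=> pp; rewrite eltE // vgen_word. Qed.

(** * Removing trailing inverse letters *)

Fixpoint stem w : seq (letter G) :=
  if w is x :: w' then
    if stem w' is [::] then (if x is Pos _ then [:: x] else [::])
    else x :: stem w'
  else [::].

Lemma stemP w : exists us, w = stem w ++ map (@Inv G) us.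
Proof.
elim: w => [|x w [us wE]] /=; first by exists [::].
case: (stem w) wE => [|y b] wE; last by exists us; rewrite {1}wE.
by case: x => e; [exists us | exists (e :: us)]; rewrite /= {1}wE.
Qed.

Lemma stem_ends v w : ~ ends_in_inv (v, stem w).
Proof.
elim: w => [|x w IHw] /=; first by case=> -[|? ?] [e].
case: (stem w) IHw => [|y b] IHw.
  by case: x => e; case=> -[|? [|? ?]] [f].
by case=> -[|z c] [e] //= [_ E]; apply: IHw; exists c, e.
Qed.

(** If [q = a e^-1] then [q q^-1 = a e^-1 e a^-1 = a a^-1]. *)
Lemma idem_invs v w us : is_path (v, w ++ map (@Inv G) us) ->
  idem (v, w ++ map (@Inv G) us) = idem (v, w).
Proof.
elim/last_ind: us => [|us e IHus]; first by rewrite cats0.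
rewrite map_rcons -rcons_cat => pe.
have pw := pe; rewrite -cats1 in pw; have {}pw := is_path_cat pw.
rewrite -IHus // !idemE // !eltE // word_rcons invSM invS_lgen /=.
have C := conflict_Pos e.
rewrite mulsA -(mulsA _ (lgen (Inv e))).
have := lgen_conflict C; rewrite eqxx /= => ->.
have pp : subrel (@plink G) (@plink G) by [].
rewrite is_pathE in pe; have /= <- := prng_walk_rcons pp pe.
by rewrite word_vgen.
Qed.

(** * Products of idempotents of paths *)

Definition idems gs t : SEC G := foldr (fun p t => idem p * t) t gs.

Lemma idems_mulr gs s t : idems gs s * t = idems gs (s * t).
Proof. by elim: gs => //= p gs IHgs; rewrite -IHgs mulsA. Qed.

Lemma idems_commute gs s t : s * s = s -> {in gs, forall p, is_path p} ->
  s * idems gs t = idems gs (s * t).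
Proof.
move=> ss; elim: gs => //= p gs IHgs pgs; rewrite -IHgs; last first.
  by move=> q qgs; apply: pgs; rewrite inE qgs orbT.
have pp : is_path p by apply: pgs; rewrite inE eqxx.
by rewrite (mulsA s) (mulsA _ s) (idempotents_commute ss (idem_idempotent pp)).
Qed.

Lemma idems_absorb gs p t : {in gs, forall p, is_path p} -> p \in gs ->
  idem p * idems gs t = idems gs t.
Proof.
elim: gs => //= q gs IHgs pgs; rewrite inE => /orP[/eqP->|pin].
  by rewrite mulsA idem_idempotent //; apply: pgs; rewrite inE eqxx.
have pgs' : {in gs, forall p, is_path p}.
  by move=> r rgs; apply: pgs; rewrite inE rgs orbT.
have pq : is_path q by apply: pgs; rewrite inE eqxx.
by rewrite mulsA (idem_commute (pgs' _ pin) pq) -mulsA IHgs.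
Qed.

Lemma idems_le gs gs' t : {in gs, forall p, is_path p} ->
  {in gs', forall p, is_path p} ->
  {in gs, forall p, exists2 q, q \in gs' & idem p * idem q = idem q} ->
  idems gs (idems gs' t) = idems gs' t.
Proof.
move=> pgs pgs'; elim: gs pgs => //= p gs IHgs pgs h; rewrite IHgs.
- have [q qin pq] : exists2 q, q \in gs' & idem p * idem q = idem q.
    by apply: h; rewrite inE eqxx.
  by rewrite -(idems_absorb t pgs' qin) mulsA pq.
- by move=> q qgs; apply: pgs; rewrite inE qgs orbT.
- by move=> q qgs; apply: h; rewrite inE qgs orbT.
Qed.

Lemma idems_swap gs gs' t : {in gs, forall p, is_path p} ->
  {in gs', forall p, is_path p} ->
  idems gs (idems gs' t) = idems gs' (idems gs t).
Proof.
move=> pgs pgs'; elim: gs' pgs' => //= p gs' IHgs' pgs'.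
rewrite -IHgs'; last by move=> q qgs; apply: pgs'; rewrite inE qgs orbT.
have pp : is_path p by apply: pgs'; rewrite inE eqxx.
by rewrite (idems_commute _ (idem_idempotent pp) pgs).
Qed.

(** A product of idempotents depends only on the filter that its factors
    generate: each of the two products absorbs the factors of the other. *)
Lemma idems_eq gs gs' t : {in gs, forall p, is_path p} ->
  {in gs', forall p, is_path p} ->
  {in gs, forall p, exists2 q, q \in gs' & idem p * idem q = idem q} ->
  {in gs', forall q, exists2 p, p \in gs & idem q * idem p = idem p} ->
  idems gs t = idems gs' t.
Proof.
move=> pgs pgs' h h'.
by rewrite -(idems_le t pgs pgs' h) idems_swap // idems_le.
Qed.

(** Two incompatible paths branch by edges [x], [y] of the same colour; between
    [linv x] and [y] stands an idempotent, which commutes with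
    [x * linv x]; this brings [linv x] next to [y], and [linv x * y = 0]. *)
Lemma incompatible0 p q : Cseparated p -> Cseparated q -> p.1 = q.1 ->
  ~ Ccompatible q p -> idem p * idem q = zeroS.
Proof.
case: p q => v a [u b] ca cb /= vu; rewrite -{u}vu in cb *.
have pa : is_path (v, a) by case: ca.
have pb : is_path (v, b) by case: cb.
move/CseparatedE: ca => ca; move/CseparatedE: cb => cb.
case/(Cincompatible_fork ca cb) => c [x [y [a' [b' [aE bE xy cxy]]]]].
have z0 : invS (elt (v, a)) * elt (v, b) = zeroS.
  rewrite aE bE in pa pb *.
  rewrite !elt_cat // !invSM; set s := elt _; set u := prng _.
  have sx : u = lsrc x.
    by move: pa; rewrite is_pathE => /walk_cat[] // _ /andP[/eqP->].
  have sy : u = lsrc y.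
    by move: pb; rewrite is_pathE => /walk_cat[] // _ /andP[/eqP->].
  rewrite {1}sx sy !word_cons invSM invS_lgen.
  set a1 := word _ a'; set b1 := word _ b'.
  have lxE : lgen (linv x) = lgen (linv x) * (lgen x * invS (lgen x)).
    by rewrite mulsA -invS_lgen mulVSV.
  have : lgen (linv x) * (invS s * s) * lgen y = zeroS.
    rewrite lxE -(mulsA (lgen (linv x))).
    rewrite (idempotents_commute (mulSV_idempotent _) (mulVS_idempotent _)).
    rewrite -!mulsA invS_lgen (lgen_conflict cxy) (negbTE xy).
    by rewrite !mulS0.
  move=> E; have -> : invS a1 * lgen (linv x) * invS s * (s * (lgen y * b1)) =
      invS a1 * (lgen (linv x) * (invS s * s) * lgen y) * b1 by rewrite !mulsA.
  by rewrite E mulS0 mul0S.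
by rewrite !idemE // -mulsA (mulsA (invS _)) z0 mul0S mulS0.
Qed.

End Words.

(** * Existence of the normal form *)

(** A new element is either below one already kept, or is kept and evicts those
    below it. *)
Lemma maximal_elements (T : eqType) (le : rel T) (l : seq T) :
  reflexive le -> transitive le ->
  exists l', [/\ {subset l' <= l},
    pairwise (fun a b => ~~ le a b && ~~ le b a) l' &
    {in l, forall a, exists2 b, b \in l' & le a b}].
Proof.
move=> le_refl le_trans; elim: l => [|a l [l' [sub anti dom]]].
  by exists [::].
have [/hasP[b bs' ab]|/hasPn na] := boolP (has (le a) l').
  exists l'; split=> //; first by move=> c /sub cs; rewrite inE cs orbT.
  by move=> c; rewrite inE => /orP[/eqP->|/dom //]; exists b.
exists (a :: [seq b <- l' | ~~ le b a]); split.
- move=> c; rewrite !inE mem_filter => /orP[->//|/andP[_ /sub->]].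
  by rewrite orbT.
- rewrite pairwise_cons pairwise_filter // andbT.
  by apply/allP => b; rewrite mem_filter => /andP[-> /na ->].
- move=> c; rewrite inE => /orP[/eqP->|/dom[b bs' cb]].
    by exists a; rewrite ?inE ?eqxx.
  have [ba|nba] := boolP (le b a).
    by exists a; rewrite ?inE ?eqxx //; apply: le_trans ba.
  by exists b => //; rewrite inE mem_filter nba bs' orbT.
Qed.

Section Existence.

Variable G : separatedGraph.
Implicit Types (v u : vertex G) (x y : letter G) (a b w : seq (letter G)).
Implicit Types (p q lam : gpath G) (gs : seq (gpath G)) (s t z : SEC G).

Definition based v gs := {in gs, forall p, Cseparated p /\ p.1 = v}.

(** The shape of a normal form, without the conditions that make it unique. *)
Definition preform z := exists gs lam,
  [/\ based lam.1 gs, Cseparated lam & z = idems gs (elt lam)].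

Definition zero_or_preform z := z = zeroS \/ preform z.

Lemma preform_vgen v : preform (vgen v).
Proof.
by exists [::], (v, [::]); split=> //; apply/CseparatedE.
Qed.

Lemma mulr0 z : z * zeroS = zeroS :> SEC G. Proof. exact: mulS0. Qed.

Lemma idems0 gs : idems gs zeroS = zeroS :> SEC G.
Proof. by elim: gs => //= p gs ->; apply: mulr0. Qed.

Lemma preform_mul_vgen z v : preform z -> zero_or_preform (z * vgen v).
Proof.
move=> [gs [lam [bgs clam ->]]]; rewrite idems_mulr.
have pl : is_path lam by case: clam.
rewrite eltE // -word_vgen -mulsA.
have [<-|nv] := eqVneq (prng (lam.1, lam.2)) v.
  right; exists gs, lam; split=> //.
  by rewrite vgen_idempotent word_vgen eltE.
by left; rewrite vgen_orthogonal // mulr0 idems0.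
Qed.

(** Right multiplication by a letter either extends [lam], or vanishes, or
    cancels the last letter [y] of [lam = a y]; in the last case
    [a y y^-1 = (a y y^-1 a^-1) a] contributes the idempotent of [lam]. *)
Lemma preform_mul_lgen z x : preform z -> zero_or_preform (z * lgen x).
Proof.
move=> [gs [[v w] [/= bgs clam ->]]]; rewrite idems_mulr.
have pl : is_path (v, w) by case: clam.
have cp : subrel (@clink G) (@plink G) by move=> ? ? /rlinkW/plinkW.
have wl : walk (@clink G) v w by apply/CseparatedE.
have [sx|sx] := eqVneq (prng (v, w)) (lsrc x); last first.
  left; rewrite eltE //= -word_vgen -vgen_lgen -mulsA (mulsA (vgen _)).
  by rewrite vgen_orthogonal // mul0S mulr0 idems0.
have [ok|nok] := pselect (forall a y, w = rcons a y -> clink y x).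
  right; have wx := walk_rcons wl sx ok.
  exists gs, (v, rcons w x); split=> //; first exact/CseparatedE.
  rewrite eltE // eltE ?word_rcons // is_pathE.
  by apply: sub_walk wx.
move/existsNP: nok => [a /existsNP[y /not_implyP[wE /negP]]].
rewrite wE in pl sx wl clam *; rewrite prng_rcons in sx.
have pa : is_path (v, a) by move: pl; rewrite -cats1; apply: is_path_cat.
rewrite eltE //= word_rcons -mulsA.
rewrite /clink /rlink /plink sx eqxx /= negb_and !negbK.
have [xy _|xy /= cxy] := eqVneq x (linv y).
- right; exists (rcons gs (v, rcons a y)), (v, a); split.
  + move=> p; rewrite mem_rcons inE => /orP[/eqP->|] //; exact: bgs.
  + by apply/CseparatedE; move: wl; rewrite -cats1; apply: walk_csep_prefix.
  rewrite /idems foldr_rcons; congr foldr.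
  rewrite idemE // !eltE //= word_rcons invSM.
  rewrite xy -invS_lgen; set t := word v a; set l := lgen y.
  have -> : t * l * (invS l * invS t) * t = t * (l * invS l * (invS t * t)).
    by rewrite !mulsA.
  rewrite (idempotents_commute (mulSV_idempotent _) (mulVS_idempotent _)).
  by rewrite !mulsA mulSVS.
- left; have := lgen_conflict cxy; rewrite linvK => ->.
  by rewrite eq_sym (negbTE xy) mulr0 idems0.
Qed.

Lemma zero_or_preform_mul z t : (preform z -> zero_or_preform (z * t)) ->
  zero_or_preform z -> zero_or_preform (z * t).
Proof. by move=> h [->|/h //]; left; apply: mul0S. Qed.

(** The elements of S(E,C) are products of generators, and the generators are
    closed under inversion. *)
Lemma zero_or_preform_all z : zero_or_preform z.
Proof.
pose good z := zero_or_preform z /\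
  forall t, zero_or_preform t -> zero_or_preform (t * z).
have good0 : good zeroS by split=> [|t _]; left; rewrite ?mulr0.
have goodv v : good (vgen v).
  split=> [|t]; first by right; apply: preform_vgen.
  by apply: zero_or_preform_mul; apply: preform_mul_vgen.
have goodl x : good (lgen x).
  have h t : zero_or_preform t -> zero_or_preform (t * lgen x).
    by apply: zero_or_preform_mul; apply: preform_mul_lgen.
  by split=> //; rewrite -vgen_lgen; apply: h; right; apply: preform_vgen.
have goodM s t : good s -> good t -> good (s * t).
  move=> [s1 s2] [t1 t2]; split; first exact: t2.
  by move=> r /s2 /t2; rewrite mulsA.
suff [] : good z /\ good (invS z) by case.
rewrite -[z]repK; elim: (rep z) => {z} [|v|x|a [a1 a2] b [b1 b2]|a [a1 a2]].
- by rewrite -[cls _]/(zeroS : SEC G) invS0.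
- by rewrite -[cls _]/(vgen v) (invS_idempotent (vgen_idempotent v)).
- by rewrite -[cls _]/(lgen x) invS_lgen.
- by rewrite -mulcls invSM; split; apply: goodM.
- by rewrite -invSEC_cls -[invSEC _]/(invS (cls a)) invSK.
Qed.

(** * Normalisation *)

Lemma prefix_le_refl : reflexive (@prefix_le G).
Proof. by move=> p; rewrite /prefix_le eqxx prefix_refl. Qed.

Lemma prefix_le_trans : transitive (@prefix_le G).
Proof.
move=> q p r /andP[/eqP pq pq2] /andP[/eqP qr qr2].
by rewrite /prefix_le pq qr eqxx (prefix_trans pq2).
Qed.

Definition gstem p : gpath G := (p.1, stem p.2).

Lemma gstem_Cseparated p : Cseparated p -> Cseparated (gstem p).
Proof.
case: p => v w /CseparatedE cw; apply/CseparatedE => /=.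
have [us wE] := stemP w; rewrite wE in cw.
exact: walk_csep_prefix cw.
Qed.

Lemma idem_gstem p : is_path p -> idem (gstem p) = idem p.
Proof.
case: p => v w pw; have [us wE] := stemP w.
by rewrite /gstem /= [in RHS]wE idem_invs // -wE.
Qed.

Lemma is_source_nf gs lam : based lam.1 gs -> Cseparated lam ->
  idems gs (elt lam) <> zeroS -> is_source (idems gs (elt lam)) lam.1.
Proof.
move=> bgs clam nz.
have fixv : vgen lam.1 * idems gs (elt lam) = idems gs (elt lam).
  have pl : is_path lam by case: clam.
  case: gs bgs {nz} => [|p gs] bgs /=; first exact: vgen_elt.
  have [[pp _ _] <-] : Cseparated p /\ p.1 = lam.1.
    by apply: bgs; rewrite inE eqxx.
  by rewrite mulsA /idem (mulsA (vgen _)) vgen_elt.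
split=> // u uz; apply/eqP/negP => /negP nu; apply: nz.
by rewrite -fixv -uz mulsA vgen_orthogonal // mul0S.
Qed.

Theorem scheiblich_exists z : z <> zeroS ->
  exists gs lam, scheiblich_form z gs lam.
Proof.
case: (zero_or_preform_all z) => [->//|[gs [lam [bgs clam zE]]]] nz.
have pl : is_path lam by case: clam.
have bgs1 : based lam.1 (map gstem (lam :: gs)).
  move=> p /mapP[q qgs ->].
  have [cq <-] : Cseparated q /\ q.1 = lam.1.
    by move: qgs; rewrite inE => /orP[/eqP->|/bgs].
  by split=> //; apply: gstem_Cseparated.
have [gs2 [sub anti dom]] :=
  maximal_elements (map gstem (lam :: gs)) prefix_le_refl prefix_le_trans.
have bgs2 : based lam.1 gs2 by move=> p /sub /bgs1.
have bpath g : based lam.1 g -> {in g, forall p, is_path p}.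
  by move=> bg p /bg[[]].
(* Listing [lam] itself is harmless, as [lam = lam lam^-1 lam]; its stem then
   lies below a kept path. *)
have bgs0 : based lam.1 (lam :: gs).
  by move=> p; rewrite inE => /orP[/eqP->|/bgs].
have below q : q \in lam :: gs ->
    exists2 p, p \in gs2 & prefix_le (gstem q) p.
  by move=> qgs; apply: dom; apply: map_f.
have zE2 : z = idems gs2 (elt lam).
  have -> : z = idems (lam :: gs) (elt lam).
    rewrite zE /= idems_commute ?idem_idempotent //; last exact: bpath bgs.
    by rewrite idemE // mulSVS.
  apply: idems_eq; [exact: bpath bgs0 | exact: bpath bgs2 | |].
  - move=> q qgs; have [p pgs2 qp] := below _ qgs; exists p => //.
    rewrite -idem_gstem; last exact: bpath bgs0 _ qgs.
    by apply: idem_prefix qp; apply: bpath bgs2 _ pgs2.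
  - move=> p /sub /mapP[q qgs ->]; exists q => //.
    have pq : is_path q by apply: bpath bgs0 _ qgs.
    by rewrite idem_gstem // idem_idempotent.
have [p0 p0gs lamp0] := below lam (mem_head _ _).
exists gs2, lam; split=> //; last first.
  by rewrite zE2; apply: is_source_nf; rewrite -?zE2.
split; first split=> //.
- by case: gs2 p0gs {sub anti dom bgs2 below zE2}.
- by move=> p /bgs2[].
- move=> p q pgs qgs; apply/not_notP => ncpt; apply: nz.
  have [[cp pv] [cq qv]] := (bgs2 _ pgs, bgs2 _ qgs).
  have pgs2 := bpath _ bgs2.
  rewrite zE2 -(idems_absorb _ pgs2 pgs) -(idems_absorb _ pgs2 qgs) mulsA.
  rewrite idem_commute ?pgs2 // incompatible0 ?mul0S //; congruence.
- by move=> p /sub /mapP[q _ ->]; apply: stem_ends.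
- by move=> p /bgs2[].
exists p0 => //; rewrite -(idem_gstem pl) idem_prefix //.
exact: bpath bgs2 _ p0gs.
Qed.

End Existence.

(** * Representation of S(E,C) on trees *)

Section Trees.

Variable G : separatedGraph.
Implicit Types (v u : vertex G) (x y : letter G) (a b c w : seq (letter G)).
Implicit Types (W : seq (letter G) -> Prop).
Implicit Types (p q lam : gpath G) (gs : seq (gpath G)) (s t z : SEC G).

Lemma reduced_no_backtrack v a x :
  ~ walk (@rlink G) v (rcons (rcons a (linv x)) x).
Proof.
move=> /andP[_ /infix2_sorted /(_ (linv x) x)].
rewrite /rlink linvK eqxx andbF => h.
by suff : false by []; apply: h; rewrite -!cats1 -catA suffix_infix.
Qed.

(** Right multiplication by [x] in the free groupoid, restricted to [W]; the two
    alternatives are the absence and the presence of cancellation. *)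
Definition move W x a b :=
  [/\ W a, W b & b = rcons a x \/ a = rcons b (linv x)].

(** The sets of paths on which S(E,C) acts: [tree_Inv] makes [Inv e * Pos e]
    act as a vertex, and [tree_fork] makes [Inv e * Pos f] act as zero for
    distinct [e] and [f] of one colour. *)
Record tree v W : Prop := {
  tree_reduced : forall w, W w -> walk (@rlink G) v w;
  tree_prefix : forall a b, W (a ++ b) -> W a;
  tree_Inv : forall e a,
    W a -> prng (v, a) = rng e -> exists b, move W (Inv e) a b;
  tree_fork : forall x y a b c,
    conflict x y -> move W x a b -> move W y a c -> x = y
}.

Section Action.

Variables (v : vertex G) (W : seq (letter G) -> Prop).
Hypothesis treeW : tree v W.

Lemma move_linv x a b : move W x a b <-> move W (linv x) b a.
Proof.
by rewrite /move linvK; split=> -[? ? []]; split=> //; [right|left|right|left].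
Qed.

Lemma no_backtrack x a : ~ W (rcons (rcons a (linv x)) x).
Proof. by move/(tree_reduced treeW); apply: reduced_no_backtrack. Qed.

Lemma move_fun x a b c : move W x a b -> move W x a c -> b = c.
Proof.
move=> [_ Wb ab] [_ Wc ac]; case: ab ac => [bE|aE] [cE|aE'].
- by rewrite bE cE.
- by move: Wb; rewrite bE aE' => /no_backtrack.
- by move: Wc; rewrite cE aE => /no_backtrack.
- by move: aE'; rewrite aE => /rcons_inj[].
Qed.

Lemma move_inj x a b c : move W x a c -> move W x b c -> a = b.
Proof. by move=> /move_linv ac /move_linv bc; apply: move_fun ac bc. Qed.

Lemma move_src x a b : move W x a b -> prng (v, a) = lsrc x.
Proof.
case=> Wa Wb []; last by move->; rewrite prng_rcons lrng_linv.
move=> E; rewrite E in Wb.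
exact: prng_walk_rcons (@plinkW G) (tree_reduced treeW Wb).
Qed.

Lemma move_rng x a b : move W x a b -> prng (v, b) = lrng x.
Proof. by move/move_linv/move_src; rewrite lsrc_linv. Qed.

Definition lact x : pbij (seq (letter G)) := PBij (@move_fun x) (@move_inj x).

Definition stay u a b := [/\ W a, prng (v, a) = u & a = b].

Fact stay_fun u a b c : stay u a b -> stay u a c -> b = c.
Proof. by move=> [_ _ <-] []. Qed.

Fact stay_inj u a b c : stay u a c -> stay u b c -> a = b.
Proof. by move=> [_ _ ->] []. Qed.

Definition vact u : pbij (seq (letter G)) := PBij (@stay_fun u) (@stay_inj u).

Lemma tree_relations : satisfies_relations vact lact.
Proof.
split=> [u u'|x|x|X e f CX Xe Xf].
- apply: pbij_ext => a c; case: eqVneq => [<-|/eqP uu'].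
    split=> [[b [? ? ab] [? ? bc]]|ac]; first by split=> //; rewrite ab.
    by exists a => //; case: ac.
  by split=> // -[b [_ au ab] [_ bu' _]]; apply: uu'; rewrite -au -bu' ab.
- apply: pbij_ext => a c; split=> [[b [_ _ ->]]//|ac].
  by exists a => //; split=> //; [case: ac | apply: move_src ac].
- apply: pbij_ext => a c; split=> [[b ab [_ _ <-]]//|ac].
  by exists c => //; split=> //; [case: ac | apply: move_rng ac].
- have cef : conflict (Pos e) (Pos f) by apply/asboolP; exists X, e, f.
  apply: pbij_ext => a c; case: asboolP => [<-|ef]; split=> //.
  + move=> [b /[dup] ab /move_linv /= ba bc].
    rewrite (move_fun ba bc) in ab *.
    by split=> //; [case: ab | apply: (move_src ab)].
  + move=> [Wa ae <-]; have [b ab] := tree_Inv treeW Wa ae.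
    by exists b => //; apply/move_linv.
  + move=> [b /move_linv /= ba bc].
    by have [] := tree_fork treeW cef ba bc.
Qed.

(** Reading off an element of S(E,C) from the root of [W]: a C-separated path
    can be followed exactly when [W] contains it, and its idempotent tests
    this and returns to the root. *)
Lemma tree_reading : exists run : SEC G -> seq (letter G) -> Prop,
  [/\ forall b, ~ run zeroS b,
      forall p b, Cseparated p -> p.1 = v ->
        run (elt p) b <-> W p.2 /\ b = p.2 &
      forall p t b, Cseparated p -> p.1 = v ->
        run (idem p * t) b <-> W p.2 /\ run t b].
Proof.
have [h [[hM h0 hv hl] _]] := SEC_universal tree_relations.
have hI s : h (invS s) = invS (h s).
  by apply: invS_uniq; rewrite -!hM ?mulSVS ?mulVSV.
have runE w b : walk (@rlink G) v w -> h (word v w) [::] b <-> W w /\ b = w.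
  elim/last_ind: w b => [|w x IHw] b ww.
    by rewrite hv; split=> [[? _ <-]|[? ->]].
  have ww' : walk (@rlink G) v w.
    by move: ww; rewrite -cats1; case/(walk_cat (@plinkW G)).
  rewrite word_rcons hM hl; split.
    move=> [c /(IHw _ ww') [Ww ->] [_ Wb [bE|wE]]].
      by rewrite -bE.
    by rewrite wE in ww; have := reduced_no_backtrack ww.
  move=> [Wx ->]; have Ww : W w.
    by move: Wx; rewrite -cats1 => /(tree_prefix treeW).
  by exists w; [apply/IHw | split=> //; left].
have runP p b : Cseparated p -> p.1 = v ->
    h (elt p) [::] b <-> W p.2 /\ b = p.2.
  case: p => u w cp /= uv; rewrite {}uv in cp *.
  rewrite eltE; last by case: cp.
  by apply: runE; apply: sub_walk (@rlinkW G) _; apply/CseparatedE.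
exists (fun z => h z [::]); split=> //.
  by move=> b; rewrite h0.
move=> p t b cp pv; rewrite idemE; last by case: cp.
rewrite !hM hI; split.
  move=> [d [c /(runP _ _ cp pv) [Wp cE] dc] db]; split=> //.
  have pc : h (elt p) [::] c by apply/runP.
  by rewrite (pbij_inj pc dc).
move=> [Wp tb]; exists [::] => //; have pp : h (elt p) [::] p.2 by apply/runP.
by exists p.2.
Qed.

End Action.

(** * The tree spanned by a compatible family *)

(** The prefixes of the family are not enough: a tree has to be closed under
    inverse letters, whence the tail [us]. *)
Definition hull v gs w := walk (@rlink G) v w /\
  exists a us p, [/\ w = a ++ map (@Inv G) us, p \in gs & prefix a p.2].

Lemma hull_mem v gs p : Cseparated p -> p.1 = v -> p \in gs -> hull v gs p.2.
Proof.
case: p => u w cp /= uv pgs; rewrite {}uv in cp pgs *; split.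
  by apply: sub_walk (@rlinkW G) _; apply/CseparatedE.
by exists w, [::], (v, w); rewrite cats0 prefix_refl.
Qed.

Lemma hull_stem v gs w : hull v gs w -> ~ ends_in_inv (v, w) ->
  exists2 p, p \in gs & prefix w p.2.
Proof.
move=> [_ [a [us [p [-> pgs ap]]]]]; case/lastP: us => [|us e].
  by exists p => //; rewrite cats0.
by case; exists (a ++ map (@Inv G) us), e; rewrite map_rcons rcons_cat.
Qed.

Lemma hull_Pos v gs w e : hull v gs (rcons w (Pos e)) ->
  exists p c, p \in gs /\ p.2 = w ++ Pos e :: c.
Proof.
case/hull_stem=> [[c [f /rcons_inj[]]]//|p pgs /prefixP[c pE]].
by exists p, c; rewrite pE cat_rcons.
Qed.

(** Two distinct edges of one colour leaving [w] within the hull either both continue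
    prefixes of the family, which compatibility excludes, or one of them leads
    back along the last letter of [w], and then the other one would follow it in
    a C-separated path. *)
Lemma hull_tree v gs : {in gs, forall p, Cseparated p} ->
  {in gs, forall p, p.1 = v} -> {in gs &, forall p q, Ccompatible p q} ->
  tree v (hull v gs).
Proof.
move=> cgs vgs cpt.
have wgs p : p \in gs -> walk (@clink G) v p.2.
  move=> pgs; rewrite -(vgs _ pgs); apply/CseparatedE.
  by case: p pgs => u w /cgs.
have hpre a b : hull v gs (a ++ b) -> hull v gs a.
  move=> [wab [c [us [p [abE pgs cp]]]]].
  split; first by case/(walk_cat (@plinkW G)): wab.
  have := congr1 (take (size a)) abE; rewrite take_size_cat // take_cat.
  case: ltnP => _ ->.
    exists (take (size a) c), [::], p; rewrite cats0; split=> //.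
    exact: prefix_trans (prefix_take _ _) cp.
  by exists c, (take (size a - size c) us), p; rewrite map_take.
split=> //; first by move=> w [].
- move=> e w Ww we; have [ww [a [us [p [wE pgs ap]]]]] := Ww.
  have [[b bE]|npos] := pselect (exists b, w = rcons b (Pos e)).
    exists b; split=> //; last by right.
    by apply: (hpre b [:: Pos e]); rewrite cats1 -bE.
  exists (rcons w (Inv e)); split=> //; last by left.
  split; last first.
    by exists a, (rcons us e), p; rewrite map_rcons -rcons_cat -wE.
  apply: walk_rcons => // b y bE; apply/andP; split.
    by move: we; rewrite bE prng_rcons /plink => ->.
  by apply/negP => /eqP E; apply: npos; exists b; rewrite bE -[y]linvK -E.
- move=> x y w b c /[dup] cxy /asboolP[X [e [f [CX Xe Xf xE yE]]]].
  move=> [Ww Wb wb] [_ Wc wc]; case: wb wc Wb Wc => [->|wx] [->|wy] Wb Wc.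
  + move: Wb Wc; rewrite xE yE.
    move=> /hull_Pos[p [p' [pgs pE]]] /hull_Pos[q [q' [qgs qE]]].
    have := cpt _ _ qgs pgs; have := wgs _ pgs; have := wgs _ qgs.
    rewrite (surjective_pairing p) (surjective_pairing q) /= pE qE !vgs //.
    by move=> wq wp pq; apply: Ccompatible_no_fork wp wq pq _; rewrite -xE -yE.
  + move: Wb; rewrite xE => /hull_Pos[p [p' [pgs pE]]].
    have := wgs _ pgs; rewrite pE wy cat_rcons => /andP[_ /cat_sorted2[_]].
    by rewrite /= {1}/clink linvK -xE (conflict_sym cxy) andbF.
  + move: Wc; rewrite yE => /hull_Pos[p [p' [pgs pE]]].
    have := wgs _ pgs; rewrite pE wx cat_rcons => /andP[_ /cat_sorted2[_]].
    by rewrite /= {1}/clink linvK -yE cxy andbF.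
  + by move: wy; rewrite wx => /rcons_inj[_ /(can_inj (@linvK G))].
Qed.

Lemma family_tree gs lam :
  scheiblich_family gs lam -> tree lam.1 (hull lam.1 gs).
Proof. by case=> _ cgs _ cpt _ _ vgs; apply: hull_tree. Qed.

(** * Uniqueness of the normal form *)

Lemma family_reading gs lam W run : scheiblich_family gs lam ->
  (forall p b, Cseparated p -> p.1 = lam.1 ->
     run (elt p) b <-> W p.2 /\ b = p.2) ->
  (forall p t b, Cseparated p -> p.1 = lam.1 ->
     run (idem p * t) b <-> W p.2 /\ run t b) ->
  forall b, run (nf_value gs lam) b <->
    [/\ {in gs, forall p, W p.2}, W lam.2 & b = lam.2].
Proof.
case=> _ cgs _ _ _ clam vgs runP runI b.
have h r : {subset r <= gs} -> run (idems r (elt lam)) b <->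
    {in r, forall p, W p.2} /\ run (elt lam) b.
  elim: r => [|p r IHr] sub /=; first by split=> // -[].
  have pgs : p \in gs by apply: sub; rewrite inE eqxx.
  have {}sub : {subset r <= gs} by move=> q qr; apply: sub; rewrite inE qr orbT.
  rewrite runI ?vgs //; last exact: cgs.
  rewrite IHr //; split=> [[Wp [Wr ?]]|[Wr ?]]; last first.
    split; first by apply: Wr; rewrite inE eqxx.
    by split=> // q qr; apply: Wr; rewrite inE qr orbT.
  by split=> // q; rewrite inE => /orP[/eqP->|/Wr].
rewrite -[nf_value _ _]/(idems gs (elt lam)) h // runP //.
by split=> [[? []]|[]].
Qed.

(** The equation [idem p = idem lam * idem p] is evaluated at the root: the left
    side is defined there, so the path [lam] can be followed. *)
Lemma dominated_hull gs lam : scheiblich_family gs lam -> dominated gs lam ->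
  hull lam.1 gs lam.2.
Proof.
move=> fam [p pgs pE]; have [_ cgs _ _ _ clam vgs] := fam.
have [run [_ runP runI]] := tree_reading (family_tree fam).
have c0 : Cseparated (lam.1, [::]) by apply/CseparatedE.
have Wp : hull lam.1 gs p.2 by apply: hull_mem; [exact: cgs|exact: vgs|].
have W0 : hull lam.1 gs [::].
  by apply: (tree_prefix (family_tree fam) (b := p.2)).
have : run (idem p * elt (lam.1, [::])) [::].
  by apply/runI; [exact: cgs|exact: vgs|split=> //; apply/runP].
by rewrite pE -mulsA => /(runI _ _ _ clam erefl)[].
Qed.

(** On the tree that it spans a normal form carries the root to [lam]; another
    family whose value does the same there must fit into this tree. *)
Lemma normal_run gs lam : scheiblich_normal gs lam ->
  exists run, [/\ run (nf_value gs lam) lam.2, forall b, ~ run zeroS b &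
    forall gs' lam', scheiblich_family gs' lam' -> lam'.1 = lam.1 ->
      run (nf_value gs' lam') lam.2 ->
      lam'.2 = lam.2 /\ {in gs', forall p, hull lam.1 gs p.2}].
Proof.
move=> [fam dom]; have [run [run0 runP runI]] := tree_reading (family_tree fam).
have Wlam := dominated_hull fam dom; have [_ cgs _ _ _ _ vgs] := fam.
exists run; split=> //.
  rewrite (family_reading fam runP runI); split=> // p pgs.
  by apply: hull_mem; [exact: cgs|exact: vgs|].
move=> gs' lam' fam' E.
have := @family_reading gs' lam' (hull lam.1 gs) run fam'; rewrite E => R.
by case/(R runP runI).
Qed.

Lemma normal_neq0 gs lam : scheiblich_normal gs lam -> nf_value gs lam <> zeroS.
Proof.
by case/normal_run=> run [R run0 _] E; rewrite E in R; apply: run0 R.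
Qed.

Lemma family_uniq gs lam : scheiblich_family gs lam -> uniq gs.
Proof.
case=> _ _ inc _ _ _ _; rewrite uniq_pairwise; apply: sub_pairwise inc => p q.
by case/andP=> pq _ /=; apply: contra pq => /eqP ->; apply: prefix_le_refl.
Qed.

Lemma pairwise_incomparable gs lam p q : scheiblich_family gs lam ->
  p \in gs -> q \in gs -> prefix_le p q -> p = q.
Proof.
case=> _ _ inc _ _ _ _; elim: gs inc => //= r gs IHgs /andP[/allP rgs inc].
rewrite !inE => /orP[/eqP->|pgs] /orP[/eqP->|qgs] // pq.
- by have := rgs _ qgs; rewrite pq.
- by have := rgs _ pgs; rewrite pq andbF.
- exact: IHgs.
Qed.

(** If each of two antichains of stems lies in the tree spanned by the other,
    then each element lies below one of the other antichain and that one below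
    one of the first, so they agree. *)
Lemma normal_subset gs lam gs' lam' : scheiblich_family gs lam ->
  scheiblich_family gs' lam' -> lam.1 = lam'.1 ->
  {in gs, forall p, hull lam.1 gs' p.2} ->
  {in gs', forall p, hull lam.1 gs p.2} -> {subset gs <= gs'}.
Proof.
move=> fam fam' E h h' p pgs.
have [_ _ _ _ ends _ vgs] := fam; have [_ _ _ _ ends' _ vgs'] := fam'.
have noinv u r : ~ ends_in_inv (r : gpath G) -> ~ ends_in_inv (u, r.2) by [].
have [q qgs' pq] := hull_stem (h _ pgs) (noinv _ _ (ends _ pgs)).
have [r rgs qr] := hull_stem (h' _ qgs') (noinv _ _ (ends' _ qgs')).
have pr : p = r.
  apply: (pairwise_incomparable fam) => //.
  by rewrite /prefix_le !vgs // eqxx (prefix_trans pq).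
rewrite -pr in qr; suff -> : p = q by [].
rewrite (surjective_pairing p) (surjective_pairing q).
rewrite (vgs _ pgs) (vgs' _ qgs') E.
congr pair; have [[c pE] [d qE]] := (prefixP qr, prefixP pq).
have : size q.2 = size p.2.
  by apply/eqP; rewrite eqn_leq !size_prefix.
rewrite {1}qE size_cat -[RHS]addn0 => /addnI/size0nil d0.
by rewrite qE d0 cats0.
Qed.

Lemma scheiblich_unique z gs gs' lam lam' : scheiblich_form z gs lam ->
  scheiblich_form z gs' lam' -> [/\ lam = lam', gs =i gs' & size gs = size gs'].
Proof.
move=> [zE nf [_ src]] [zE' nf' [src' _]].
have vE : lam.1 = lam'.1 by apply: src.
have [run [R _ runP]] := normal_run nf.
have [run' [R' _ runP']] := normal_run nf'.
have [fam _] := nf; have [fam' _] := nf'.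
rewrite -zE zE' in R; have [wE h'] := runP _ _ fam' (esym vE) R.
rewrite -zE' zE in R'; have [_ h] := runP' _ _ fam vE R'.
have E : gs =i gs'.
  move=> p; apply/idP/idP.
    by apply: (normal_subset fam fam') => //; rewrite vE.
  by apply: (normal_subset fam' fam); rewrite -?vE // vE.
split=> //.
  by rewrite (surjective_pairing lam) vE -wE -surjective_pairing.
apply/perm_size/uniq_perm => //; first exact: family_uniq fam.
exact: family_uniq fam'.
Qed.

Lemma dominated_stem gs lam lam0 us : scheiblich_family gs lam ->
  stem_decomposition lam lam0 us ->
  dominated gs lam <-> exists2 p, p \in gs & prefix_le lam0 p.
Proof.
move=> fam [lamE ends]; have [_ cgs _ _ _ clam vgs] := fam.
have v0 : lam0.1 = lam.1 by rewrite lamE.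
split=> [dom|[p pgs lp]].
  have := dominated_hull fam dom; rewrite [in lam.2]lamE /=.
  move/(tree_prefix (family_tree fam)) => /hull_stem[]// p pgs lp.
  by exists p => //; rewrite /prefix_le v0 vgs // eqxx.
exists p => //; have pl : is_path lam by case: clam.
rewrite lamE idem_invs; last by rewrite -lamE.
rewrite -surjective_pairing idem_prefix //.
by case: (cgs _ pgs).
Qed.

End Trees.

Theorem theorem4p6 (G : separatedGraph) :
  [/\ forall x : SEC G, x <> zeroS ->
        exists (gs : seq (gpath G)) (lam : gpath G), scheiblich_form x gs lam,
      forall (gs : seq (gpath G)) (lam : gpath G), scheiblich_family gs lam ->
        (exists (lam0 : gpath G) (w : seq (edge G)),
           stem_decomposition lam lam0 w) /\
        forall (lam0 : gpath G) (w : seq (edge G)),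
          stem_decomposition lam lam0 w ->
          (dominated gs lam <-> exists2 p, p \in gs & prefix_le lam0 p),
      forall x : SEC G, x <> zeroS ->
        forall (gs gs' : seq (gpath G)) (lam lam' : gpath G),
          scheiblich_form x gs lam -> scheiblich_form x gs' lam' ->
          [/\ lam = lam', gs =i gs' & size gs = size gs'] &
      forall (gs : seq (gpath G)) (lam : gpath G),
        scheiblich_normal gs lam -> nf_value gs lam <> zeroS].
Proof.
split.
- exact: scheiblich_exists.
- move=> gs lam fam; split; last by move=> lam0 us; apply: dominated_stem.
  have [us wE] := stemP lam.2.
  exists (gstem lam), us; split; last exact: stem_ends.
  by rewrite /= -wE -surjective_pairing.
- by move=> x _ gs gs' lam lam'; apply: scheiblich_unique.
- exact: normal_neq0.
Qed.
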